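(* Let $\mathcal{C}$ be a category, let $\mathcal{D}$ be a traced symmetric monoidal category, and let $F:\mathcal{C}\rightarrow\mathcal{D}$ be a functor. Let $N:\mathcal{D}\rightarrow\mathbf{Int}\,\mathcal{D}$ be the canonical embedding of $\mathcal{D}$ into the compact closed category $\mathbf{Int}\,\mathcal{D}$. Then the composite functor $N\circ F:\mathcal{C}\rightarrow\mathbf{Int}\,\mathcal{D}$ has a right adjoint if and only if, for every object $D$ of $\mathcal{D}$, the functor $F(-)\otimes D:\mathcal{C}\rightarrow\mathcal{D}$ has a right adjoint.
   Context: A trace on a symmetric monoidal category $\mathcal{D}$ (with tensor $\otimes$, unit $I$) is a family of maps $\mathrm{Tr}^X_{A,B}:\mathcal{D}(A\otimes X,B\otimes X)\rightarrow\mathcal{D}(A,B)$ satisfying the standard axioms of Joyal–Street–Verity (naturality in $A,B$, dinaturality in $X$, vanishing, superposing, yanking); a traced symmetric monoidal category is a symmetric monoidal category equipped with a trace. The Int-construction: $\mathbf{Int}\,\mathcal{D}$ has as objects pairs $(X,U)$ of objects of $\mathcal{D}$; a morphism $(X,U)\rightarrow(Y,V)$ is a morphism $X\otimes V\rightarrow Y\otimes U$ in $\mathcal{D}$; composition of $f:(X,U)\rightarrow(Y,V)$ and $g:(Y,V)\rightarrow(Z,W)$ is obtained by tracing out $V$ from the evident composite $X\otimes W\otimes V\rightarrow Z\otimes U\otimes V$ built from $f$, $g$ and symmetries; the tensor is $(X_1,U_1)\otimes(X_2,U_2)=(X_1\otimes X_2,U_2\otimes U_1)$ with unit $(I,I)$,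 and the dual of $(X,U)$ is $(U,X)$, making $\mathbf{Int}\,\mathcal{D}$ compact closed. The canonical embedding $N:\mathcal{D}\rightarrow\mathbf{Int}\,\mathcal{D}$ sends an object $X$ to $(X,I)$ and a morphism $f:X\rightarrow Y$ to the corresponding morphism $X\otimes I\rightarrow Y\otimes I$ (via unit isomorphisms); it is a full and faithful strong symmetric monoidal functor. In particular $\mathbf{Int}\,\mathcal{D}((X,I),(Y,D))=\mathcal{D}(X\otimes D,Y\otimes I)$. *)

(* Defs.v *)
From mathcomp Require Import ssreflect ssrfun.

Set Implicit Arguments.
Unset Strict Implicit.
Unset Printing Implicit Defensive.

Declare Scope cat_scope.
Delimit Scope cat_scope with cat.
Local Open Scope cat_scope.

(** * Categories, functors, adjunctions *)

Record category := Category {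
  obj :> Type;
  hom : obj -> obj -> Type;
  idm : forall X, hom X X;
  comp : forall X Y Z, hom Y Z -> hom X Y -> hom X Z;
  comp_idl : forall X Y (f : hom X Y), comp (idm Y) f = f;
  comp_idr : forall X Y (f : hom X Y), comp f (idm X) = f;
  compA : forall X Y Z W (h : hom Z W) (g : hom Y Z) (f : hom X Y),
    comp h (comp g f) = comp (comp h g) f }.

Arguments hom {c} X Y.
Arguments idm {c} X.
Arguments comp {c X Y Z} g f.

Notation "g ∘ f" := (comp g f) (at level 40, left associativity) : cat_scope.

Record functor (C D : category) := Functor {
  fobj :> C -> D;
  fmap : forall X Y : C, hom X Y -> hom (fobj X) (fobj Y);
  fmap_id : forall X : C, fmap (idm X) = idm (fobj X);
  fmap_comp : forall (X Y Z : C) (g : hom Y Z) (f : hom X Y),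
    fmap (g ∘ f) = fmap g ∘ fmap f }.

Arguments fmap {C D} F {X Y} f : rename.

Section FunctorComposition.
Variables (B C D : category) (G : functor C D) (F : functor B C).

Fact functor_comp_id (X : B) : fmap G (fmap F (idm X)) = idm (G (F X)).
Proof. by rewrite !fmap_id. Qed.

Fact functor_comp_comp (X Y Z : B) (g : hom Y Z) (f : hom X Y) :
  fmap G (fmap F (g ∘ f)) = fmap G (fmap F g) ∘ fmap G (fmap F f).
Proof. by rewrite !fmap_comp. Qed.

Definition functor_comp : functor B D :=
  @Functor B D (fun X => G (F X)) (fun X Y f => fmap G (fmap F f))
    functor_comp_id functor_comp_comp.

End FunctorComposition.

Record adjunction (C D : category) (F : functor C D) (G : functor D C) :=
  Adjunction {
  adj : forall (X : C) (Y : D), hom (F X) Y -> hom X (G Y);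
  adj_inv : forall (X : C) (Y : D), hom X (G Y) -> hom (F X) Y;
  adjK : forall X Y, cancel (@adj X Y) (@adj_inv X Y);
  adj_invK : forall X Y, cancel (@adj_inv X Y) (@adj X Y);
  adj_natl : forall (X X' : C) (Y : D) (u : hom X' X) (f : hom (F X) Y),
    adj (f ∘ fmap F u) = adj f ∘ u;
  adj_natr : forall (X : C) (Y Y' : D) (v : hom Y Y') (f : hom (F X) Y),
    adj (v ∘ f) = fmap G v ∘ adj f }.

Definition has_right_adjoint (C D : category) (F : functor C D) : Prop :=
  exists G : functor D C, inhabited (adjunction F G).

(** * Symmetric monoidal categories *)

Record sym_monoidal := SymMonoidal {
  smcat :> category;
  tens : smcat -> smcat -> smcat;
  tensm : forall A A' B B' : smcat,
    hom A A' -> hom B B' -> hom (tens A B) (tens A' B');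
  tunit : smcat;
  assoc : forall A B C, hom (tens (tens A B) C) (tens A (tens B C));
  assoc_inv : forall A B C, hom (tens A (tens B C)) (tens (tens A B) C);
  lunit : forall A, hom (tens tunit A) A;
  lunit_inv : forall A, hom A (tens tunit A);
  runit : forall A, hom (tens A tunit) A;
  runit_inv : forall A, hom A (tens A tunit);
  swap : forall A B, hom (tens A B) (tens B A);
  tensm_id : forall A B, tensm (idm A) (idm B) = idm (tens A B);
  tensm_comp : forall (A A' A'' B B' B'' : smcat)
    (f' : hom A' A'') (f : hom A A') (g' : hom B' B'') (g : hom B B'),
    tensm (f' ∘ f) (g' ∘ g) = tensm f' g' ∘ tensm f g;
  assocK : forall A B C, assoc_inv A B C ∘ assoc A B C = idm _;
  assoc_invK : forall A B C, assoc A B C ∘ assoc_inv A B C = idm _;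
  lunitK : forall A, lunit_inv A ∘ lunit A = idm _;
  lunit_invK : forall A, lunit A ∘ lunit_inv A = idm _;
  runitK : forall A, runit_inv A ∘ runit A = idm _;
  runit_invK : forall A, runit A ∘ runit_inv A = idm _;
  swapK : forall A B, swap B A ∘ swap A B = idm _;
  assoc_nat : forall (A A' B B' C C' : smcat)
    (f : hom A A') (g : hom B B') (h : hom C C'),
    assoc A' B' C' ∘ tensm (tensm f g) h = tensm f (tensm g h) ∘ assoc A B C;
  lunit_nat : forall (A A' : smcat) (f : hom A A'),
    lunit A' ∘ tensm (idm tunit) f = f ∘ lunit A;
  runit_nat : forall (A A' : smcat) (f : hom A A'),
    runit A' ∘ tensm f (idm tunit) = f ∘ runit A;
  swap_nat : forall (A A' B B' : smcat) (f : hom A A') (g : hom B B'),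
    swap A' B' ∘ tensm f g = tensm g f ∘ swap A B;
  triangle : forall A B,
    tensm (idm A) (lunit B) ∘ assoc A tunit B = tensm (runit A) (idm B);
  pentagon : forall A B C D,
    assoc A B (tens C D) ∘ assoc (tens A B) C D =
    tensm (idm A) (assoc B C D) ∘ assoc A (tens B C) D
      ∘ tensm (assoc A B C) (idm D);
  hexagon : forall A B C,
    assoc B C A ∘ swap A (tens B C) ∘ assoc A B C =
    tensm (idm B) (swap A C) ∘ assoc B A C ∘ tensm (swap A B) (idm C) }.

Arguments tens {s} A B.
Arguments tensm {s A A' B B'} f g.
Arguments tunit {s}.
Arguments assoc {s} A B C.
Arguments assoc_inv {s} A B C.
Arguments lunit {s} A.
Arguments lunit_inv {s} A.
Arguments runit {s} A.
Arguments runit_inv {s} A.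
Arguments swap {s} A B.

Notation "A ⊗ B" := (tens A B) (at level 38, left associativity) : cat_scope.
Notation "f ⊗m g" := (tensm f g) (at level 38, left associativity) : cat_scope.

Section TensorRight.
Variables (D : sym_monoidal) (P : D).

Fact tensor_right_comp (X Y Z : D) (g : hom Y Z) (f : hom X Y) :
  (g ∘ f) ⊗m idm P = (g ⊗m idm P) ∘ (f ⊗m idm P).
Proof. by rewrite -tensm_comp comp_idl. Qed.

(** The functor [- ⊗ P]. *)
Definition tensor_right : functor D D :=
  @Functor D D (fun X => X ⊗ P) (fun X Y f => f ⊗m idm P)
    (fun X => tensm_id X P) tensor_right_comp.

End TensorRight.

(** * Traced symmetric monoidal categories *)

Record traced := Traced {
  trsm :> sym_monoidal;
  tr : forall A B X : trsm, hom (A ⊗ X) (B ⊗ X) -> hom A B;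
  tr_natl : forall (A A' B X : trsm) (f : hom (A ⊗ X) (B ⊗ X)) (u : hom A' A),
    tr (f ∘ (u ⊗m idm X)) = tr f ∘ u;
  tr_natr : forall (A B B' X : trsm) (v : hom B B') (f : hom (A ⊗ X) (B ⊗ X)),
    tr ((v ⊗m idm X) ∘ f) = v ∘ tr f;
  tr_dinat : forall (A B X X' : trsm) (f : hom (A ⊗ X) (B ⊗ X')) (u : hom X' X),
    tr ((idm B ⊗m u) ∘ f) = tr (f ∘ (idm A ⊗m u));
  tr_vanish_unit : forall (A B : trsm) (f : hom (A ⊗ tunit) (B ⊗ tunit)),
    tr f = runit B ∘ f ∘ runit_inv A;
  tr_vanish_tens : forall (A B X Y : trsm) (f : hom (A ⊗ (X ⊗ Y)) (B ⊗ (X ⊗ Y))),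
    tr f = tr (tr (assoc_inv B X Y ∘ f ∘ assoc A X Y));
  tr_superpose : forall (A B C X : trsm) (f : hom (A ⊗ X) (B ⊗ X)),
    tr (assoc_inv C B X ∘ (idm C ⊗m f) ∘ assoc C A X) = idm C ⊗m tr f;
  tr_yank : forall X : trsm, tr (swap X X) = idm X }.

Arguments tr {t A B X} f.

(** * The Int-construction *)

Section Int.
Variable D : traced.
Implicit Types A B C X Y Z U V W : D.

Definition midswap A B C : hom (A ⊗ B ⊗ C) (A ⊗ C ⊗ B) :=
  assoc_inv A C B ∘ (idm A ⊗m swap B C) ∘ assoc A B C.

(** Objects [(X,U)]; a morphism [(X,U) -> (Y,V)] is a map [X ⊗ V -> Y ⊗ U]. *)
Definition int_obj : Type := (D * D)%type.

Definition int_hom (P Q : int_obj) : Type := hom (P.1 ⊗ Q.2) (Q.1 ⊗ P.2).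

Definition int_id (P : int_obj) : int_hom P P := idm (P.1 ⊗ P.2).

(** With [P = (X,U)], [Q = (Y,V)] and [R = (Z,W)], the trace over [V] of
    [XWV -> XVW -> YUW -> YWU -> ZVU -> ZUV]. *)
Definition int_comp (P Q R : int_obj) (g : int_hom Q R) (f : int_hom P Q) :
    int_hom P R :=
  tr (X := Q.2)
    (midswap R.1 Q.2 P.2 ∘ (g ⊗m idm P.2) ∘ midswap Q.1 P.2 R.2
      ∘ (f ⊗m idm R.2) ∘ midswap P.1 R.2 Q.2).

Lemma compK_l X Y Z (g : hom Y Z) (g' : hom Z Y) (f : hom X Y) :
  g' ∘ g = idm Y -> g' ∘ (g ∘ f) = f.
Proof. by move=> e; rewrite compA e comp_idl. Qed.

Lemma whr_comp A X Y Z (g : hom Y Z) (f : hom X Y) :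
  (g ∘ f) ⊗m idm A = (g ⊗m idm A) ∘ (f ⊗m idm A).
Proof. exact: tensor_right_comp. Qed.

Lemma whl_comp A X Y Z (g : hom Y Z) (f : hom X Y) :
  idm A ⊗m (g ∘ f) = (idm A ⊗m g) ∘ (idm A ⊗m f).
Proof. by rewrite -tensm_comp comp_idl. Qed.

Lemma assoc_inv_nat A A' B B' C C' (f : hom A A') (g : hom B B') (h : hom C C') :
  assoc_inv A' B' C' ∘ (f ⊗m (g ⊗m h)) = (f ⊗m g ⊗m h) ∘ assoc_inv A B C.
Proof.
rewrite -[LHS]comp_idr -(assoc_invK A B C) -!compA.
by rewrite (compA (f ⊗m _)) -assoc_nat -!compA compK_l // assocK.
Qed.

Lemma midswapK A B C : midswap A C B ∘ midswap A B C = idm _.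
Proof.
rewrite /midswap -!compA (compK_l _ (assoc_invK _ _ _)).
by rewrite (compA (idm A ⊗m _)) -whl_comp swapK tensm_id comp_idl assocK.
Qed.

Lemma midswap_nat A A' B C (f : hom A A') :
  midswap A' B C ∘ (f ⊗m idm B ⊗m idm C) = (f ⊗m idm C ⊗m idm B) ∘ midswap A B C.
Proof.
rewrite /midswap -!compA assoc_nat (compA (idm A' ⊗m _)) -tensm_comp swap_nat.
rewrite comp_idl -[f in f ⊗m _]comp_idr tensm_comp !compA assoc_inv_nat.
by rewrite -!compA.
Qed.

Lemma assoc_midswap A B C :
  assoc A C B ∘ midswap A B C = (idm A ⊗m swap B C) ∘ assoc A B C.
Proof. by rewrite /midswap -!compA compK_l // assoc_invK. Qed.

Lemma swap_mid_hexagon A B C :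
  assoc B C A ∘ swap A (B ⊗ C) =
  (idm B ⊗m swap A C) ∘ (assoc B A C ∘ (swap A B ⊗m idm C) ∘ assoc_inv A B C).
Proof.
rewrite !compA -hexagon -[LHS]comp_idr -(assoc_invK A B C).
by rewrite !compA.
Qed.

Lemma midswap_swap A B C :
  midswap B C A ∘ swap A (B ⊗ C) = (swap A B ⊗m idm C) ∘ assoc_inv A B C.
Proof.
rewrite /midswap -!compA swap_mid_hexagon (compA (idm B ⊗m _)) -whl_comp swapK.
by rewrite tensm_id comp_idl -!compA compK_l // assocK.
Qed.

Lemma swap_midswap A B C :
  swap (B ⊗ C) A ∘ midswap B A C = assoc A B C ∘ (swap B A ⊗m idm C).
Proof.
have e : (swap A B ⊗m idm C) ∘ (swap B A ⊗m idm C) = idm _.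
  by rewrite -whr_comp swapK tensm_id.
have h := midswap_swap A B C; have pK := midswapK B C A.
move: (midswap B A C) (midswap B C A) h pK => p q h pK.
rewrite -[LHS]comp_idr -e (compA _ (swap A B ⊗m _)).
rewrite -[swap A B ⊗m idm C]comp_idr -(assocK A B C) (compA (swap A B ⊗m _)).
by rewrite -h -!compA compK_l // compK_l // swapK.
Qed.

(** [mvl] and [full] serve to prove the braid relation for [midswap] after
    transport along [((AB)C)E -> A(B(CE))]. *)
Let mvl A B C : hom (A ⊗ (B ⊗ C)) (B ⊗ (A ⊗ C)) :=
  assoc B A C ∘ (swap A B ⊗m idm C) ∘ assoc_inv A B C.

Let mvl_braid A B C :
  mvl B C A ∘ ((idm B ⊗m swap A C) ∘ mvl A B C) =
  (idm C ⊗m swap A B) ∘ (mvl A C B ∘ (idm A ⊗m swap B C)).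
Proof.
rewrite -swap_mid_hexagon (compA (idm C ⊗m _)) -swap_mid_hexagon.
rewrite /mvl -!compA swap_nat compK_l //.
exact: assocK.
Qed.

Let full A B C E : hom (A ⊗ B ⊗ C ⊗ E) (A ⊗ (B ⊗ (C ⊗ E))) :=
  assoc A B (C ⊗ E) ∘ assoc (A ⊗ B) C E.

Let full_midswap A B C E :
  full A B E C ∘ midswap (A ⊗ B) C E =
  (idm A ⊗m (idm B ⊗m swap C E)) ∘ full A B C E.
Proof.
by rewrite /full -!compA assoc_midswap !compA -tensm_id assoc_nat.
Qed.

Let full_midswap_whr A B C E :
  full A C B E ∘ (midswap A B C ⊗m idm E) = (idm A ⊗m mvl B C E) ∘ full A B C E.
Proof.
rewrite /full !pentagon -!compA -whr_comp assoc_midswap whr_comp.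
rewrite (compA (assoc A (C ⊗ B) E)) assoc_nat -!compA !(compA (idm A ⊗m _)).
rewrite -!whl_comp /mvl -!compA assocK comp_idr.
by rewrite whl_comp !compA.
Qed.

Let full_inj A B C E Z (f g : hom Z (A ⊗ B ⊗ C ⊗ E)) :
  full A B C E ∘ f = full A B C E ∘ g -> f = g.
Proof.
move=> e; rewrite -[f]comp_idl -[g]comp_idl -(assocK (A ⊗ B) C E).
rewrite -[assoc (A ⊗ B) C E]comp_idl -(assocK A B (C ⊗ E)) -!compA.
by rewrite /full -!compA in e; rewrite e.
Qed.

Lemma midswap_braid A B C E :
  midswap (A ⊗ C) B E ∘ ((midswap A B C ⊗m idm E) ∘ midswap (A ⊗ B) E C) =
  (midswap A E C ⊗m idm B) ∘ (midswap (A ⊗ E) B C ∘ (midswap A B E ⊗m idm C)).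
Proof.
have h := full_midswap; have h' := full_midswap_whr.
have inj := full_inj; have br := mvl_braid.
move: midswap full mvl h h' inj br => p F m h h' inj br.
apply: inj; rewrite !compA h h' -!(compA _ (F _ _ _ _)) h h' !compA.
by rewrite -(compA _ (F _ _ _ _)) h -(compA _ (F _ _ _ _)) h' !compA
  -!whl_comp -!compA br.
Qed.

Lemma tr_whr A B X P (f : hom (A ⊗ X) (B ⊗ X)) :
  tr f ⊗m idm P = tr (midswap B X P ∘ (f ⊗m idm P) ∘ midswap A P X).
Proof.
have -> : tr f ⊗m idm P = swap P B ∘ ((idm P ⊗m tr f) ∘ swap A P).
  by rewrite -swap_nat compK_l // swapK.
rewrite -tr_superpose -tr_natl -tr_natr; congr tr.
have h := midswap_swap P B X; have h' := swap_midswap P A X.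
move: (midswap B X P) (midswap A P X) h h' => p q h h'.
rewrite !compA -h -!compA -h' (compA (idm P ⊗m f)) -swap_nat -!compA.
by rewrite (compA (swap P _)) swapK comp_idl.
Qed.

Lemma tr_exchange A B W V (f : hom (A ⊗ W ⊗ V) (B ⊗ W ⊗ V)) :
  tr (tr f) = tr (tr (midswap B W V ∘ f ∘ midswap A V W)).
Proof.
have -> : tr (tr f) = tr (assoc B W V ∘ f ∘ assoc_inv A W V).
  rewrite tr_vanish_tens -!compA assocK comp_idr compK_l //.
  exact: assocK.
set g := _ ∘ assoc_inv A W V.
have -> : tr g = tr ((idm B ⊗m swap W V) ∘ (g ∘ (idm A ⊗m swap V W))).
  by rewrite tr_dinat -compA -whl_comp swapK tensm_id comp_idr.
by rewrite tr_vanish_tens /g /midswap !compA.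
Qed.

Lemma tr_midswap A X : tr (midswap A X X) = idm (A ⊗ X).
Proof. by rewrite /midswap tr_superpose tr_yank tensm_id. Qed.

Lemma int_comp_idl (P Q : int_obj) (f : int_hom P Q) :
  int_comp (int_id Q) f = f.
Proof.
rewrite /int_comp /int_id tensm_id comp_idr midswapK comp_idl.
by rewrite tr_natr tr_midswap comp_idr.
Qed.

Lemma int_comp_idr (P Q : int_obj) (f : int_hom P Q) :
  int_comp f (int_id P) = f.
Proof.
rewrite /int_comp /int_id tensm_id comp_idr -(compA _ (midswap _ _ _)).
by rewrite midswapK comp_idr tr_natl tr_midswap comp_idl.
Qed.

Lemma int_compA (P Q R S : int_obj)
  (h : int_hom R S) (g : int_hom Q R) (f : int_hom P Q) :
  int_comp h (int_comp g f) = int_comp (int_comp h g) f.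
Proof.
rewrite /int_comp.
rewrite !tr_whr -!(tr_natl, tr_natr) tr_exchange.
congr (tr (tr _)).
have n := midswap_nat; have pK := midswapK; have b := midswap_braid.
move: midswap n pK b => p n pK b.
have nK A A' B C (u : hom A A') :
    u ⊗m idm B ⊗m idm C = p A' C B ∘ ((u ⊗m idm C ⊗m idm B) ∘ p A B C).
  by rewrite compA n -compA pK comp_idr.
have wpK A B C E Z (k : hom Z (A ⊗ B ⊗ C ⊗ E)) :
    (p A C B ⊗m idm E) ∘ ((p A B C ⊗m idm E) ∘ k) = k.
  by rewrite compK_l // -whr_comp pK tensm_id.
have bK A B C E Z (k : hom Z (A ⊗ B ⊗ E ⊗ C)) :
    p (A ⊗ C) B E ∘ ((p A B C ⊗m idm E) ∘ (p (A ⊗ B) E C ∘ k)) =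
    (p A E C ⊗m idm B) ∘ (p (A ⊗ E) B C ∘ ((p A B E ⊗m idm C) ∘ k)).
  by rewrite !compA -(compA (p _ B E)) b !compA.
rewrite !whr_comp [h ⊗m _ ⊗m _]nK [g ⊗m _ ⊗m _]nK [f ⊗m _ ⊗m _]nK -!compA.
by rewrite !bK !wpK !(compK_l _ (pK _ _ _)) pK comp_idr.
Qed.

Definition int_cat : category :=
  Category int_comp_idl int_comp_idr int_compA.

Definition int_embed_hom X Y (f : hom X Y) : int_hom (X, tunit) (Y, tunit) :=
  runit_inv Y ∘ f ∘ runit X.

Lemma int_embed_homE X Y (f : hom X Y) : int_embed_hom f = f ⊗m idm tunit.
Proof. by rewrite /int_embed_hom -compA -runit_nat compK_l // runitK. Qed.

Fact int_embed_id X : int_embed_hom (idm X) = int_id (X, tunit).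
Proof. by rewrite int_embed_homE tensm_id. Qed.

Fact int_embed_comp X Y Z (g : hom Y Z) (f : hom X Y) :
  int_embed_hom (g ∘ f) = int_comp (int_embed_hom g) (int_embed_hom f).
Proof.
rewrite /int_comp !int_embed_homE /=.
have n := midswap_nat; have pK := midswapK; have t := tr_midswap.
move: midswap n pK t => p n pK t.
rewrite n -!compA (compK_l _ (pK _ _ _)) compA -whr_comp tr_natr t comp_idr.
by rewrite -whr_comp.
Qed.

(** The canonical embedding [N], [X |-> (X, I)]. *)
Definition int_embed : functor D int_cat :=
  @Functor D int_cat (fun X => (X, tunit)) int_embed_hom
    int_embed_id int_embed_comp.

End Int.

(* Main.v *)
(** A right adjoint to [F] amounts to a universal arrow from [F] to every
    object. An arrow [N (F X) -> (Y, V)] of [Int D] is a map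
    [F X ⊗ V -> Y ⊗ I], that is, a map [F X ⊗ V -> Y], and precomposing it with
    [N (F u)] precomposes the map with [F u ⊗ V]. Hence universal arrows from
    [N ∘ F] to [(Y, V)] are the same as universal arrows from [F(-) ⊗ V] to
    [Y]. *)
From mathcomp Require Import ssreflect ssrfun.
From Stdlib Require Import IndefiniteDescription.
Require Import Defs.

Set Implicit Arguments.
Unset Strict Implicit.
Unset Printing Implicit Defensive.

Local Open Scope cat_scope.

Definition universal (C D : category) (F : functor C D) (Y : D) (U : C)
    (e : hom (F U) Y) : Prop :=
  forall (X : C) (f : hom (F X) Y), exists! u : hom X U, e ∘ fmap F u = f.

(** The arrow is the counit at [Y]; the unique factorization of [f] is its transpose [adj a f]. *)
Lemma adjunction_universal (C D : category) (F : functor C D)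
    (G : functor D C) (a : adjunction F G) (Y : D) :
  universal (adj_inv a (idm (G Y))).
Proof.
move=> X f; exists (adj a f); split=> [|u <-].
  by rewrite -[LHS](adjK a) adj_natl adj_invK comp_idl adjK.
by rewrite adj_natl adj_invK comp_idl.
Qed.

Section AdjointOfUniversal.
Variables (C D : category) (F : functor C D) (U : D -> C).
Variables (e : forall Y, hom (F (U Y)) Y) (eP : forall Y, universal (e Y)).

Let lift X Y (f : hom (F X) Y) :=
  constructive_indefinite_description _ (eP f).

(** Transposition, not the categorical trace: the factorization of [f] through [e Y], extracted by
    choice because [universal] only asserts existence. *)
Let tr X Y (f : hom (F X) Y) : hom X (U Y) := proj1_sig (lift f).

Let tr_eq X Y (f : hom (F X) Y) : e Y ∘ fmap F (tr f) = f.
Proof. by case: (proj2_sig (lift f)). Qed.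

Let tr_uniq X Y (f : hom (F X) Y) u : e Y ∘ fmap F u = f -> tr f = u.
Proof. by case: (proj2_sig (lift f)) => _; apply. Qed.

Let G_map Y Z (g : hom Y Z) : hom (U Y) (U Z) := tr (g ∘ e Y).

Let G_id Y : G_map (idm Y) = idm (U Y).
Proof. by apply: tr_uniq; rewrite fmap_id comp_idl comp_idr. Qed.

Let G_comp X Y Z (g : hom Y Z) (f : hom X Y) :
  G_map (g ∘ f) = G_map g ∘ G_map f.
Proof. by apply: tr_uniq; rewrite fmap_comp compA tr_eq -!compA tr_eq. Qed.

Lemma universal_has_right_adjoint : has_right_adjoint F.
Proof.
exists (Functor G_id G_comp); constructor.
exists tr (fun X Y u => e Y ∘ fmap F u) => [X Y f|X Y u|X X' Y u f|X Y Y' v f].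
- exact: tr_eq.
- exact: tr_uniq.
- by apply: tr_uniq; rewrite fmap_comp compA tr_eq.
- by apply: tr_uniq; rewrite fmap_comp compA tr_eq -compA tr_eq.
Qed.

End AdjointOfUniversal.

Lemma has_right_adjointP (C D : category) (F : functor C D) :
  has_right_adjoint F <->
  forall Y : D, exists (U : C) (e : hom (F U) Y), universal e.
Proof.
split=> [[G [a]] Y|H].
  by exists (G Y), (adj_inv a (idm (G Y))); apply: adjunction_universal.
(* Choice is applied twice, first to the object [U], then to the arrow [e]. *)
pose s Y := constructive_indefinite_description _ (H Y).
pose t Y := constructive_indefinite_description _ (proj2_sig (s Y)).
exact: (universal_has_right_adjoint (fun Y => proj2_sig (t Y))).
Qed.

(** Naturality moves [h] past the rightmost [midswap], two symmetries cancel, and the trace that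
    remains is removed by yanking. *)
Lemma int_comp_embed (D : traced) (X X' Y V : D)
    (g : int_hom (X, tunit) (Y, V)) (h : hom X' X) :
  int_comp g (int_embed_hom h) = g ∘ (h ⊗m idm V).
Proof.
rewrite /int_comp int_embed_homE /=.
have n := @midswap_nat D; have pK := @midswapK D; have t := @tr_midswap D.
(* Generalized because [compA] would otherwise unfold [midswap]. *)
move: (@midswap D) n pK t => p n pK t.
rewrite -(compA _ (_ ⊗m _)) -n -!compA (compK_l _ (pK _ _ _)).
by rewrite -tensor_right_comp tr_natl t comp_idl.
Qed.

Lemma runit_comp_inj (D : traced) (X Y : D) (f g : hom X (Y ⊗ tunit)) :
  runit Y ∘ f = runit Y ∘ g -> f = g.
Proof. by move=> E; rewrite -(compK_l f (runitK Y)) E compK_l // runitK. Qed.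

Lemma universal_int (C : category) (D : traced) (F : functor C D) (Y V : D)
    (U : C) (e : int_hom (F U, tunit) (Y, V)) :
  universal (F := functor_comp (int_embed D) F) (Y := (Y, V)) e <->
  universal (F := functor_comp (tensor_right V) F) (runit Y ∘ e).
Proof.
(* Since [runit Y] is invertible, both factorization problems have the same solutions [u]. *)
have E X (u : hom X U) (f : hom (F X ⊗ V) (Y ⊗ tunit)) :
    int_comp e (int_embed_hom (fmap F u)) = f <->
    runit Y ∘ e ∘ (fmap F u ⊗m idm V) = runit Y ∘ f.
  rewrite int_comp_embed -compA.
  by split=> [->//|/runit_comp_inj].
split=> H X f /=.
  have [u [/= /E Hu uniq]] := H X (runit_inv Y ∘ f).
  have fE : runit Y ∘ (runit_inv Y ∘ f) = f by apply/compK_l/runit_invK.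
  rewrite fE in Hu; exists u; split=> // v Hv.
  by apply: uniq; apply/E; rewrite fE.
have [u [/= /E Hu uniq]] := H X (runit Y ∘ f).
by exists u; split=> // v /E; apply: uniq.
Qed.

Theorem theorem1 (C : category) (D : traced) (F : functor C D) :
  has_right_adjoint (functor_comp (int_embed D) F) <->
  (forall A : D, has_right_adjoint (functor_comp (tensor_right A) F)).
Proof.
split=> [/has_right_adjointP H A|H]; apply/has_right_adjointP.
  move=> Y; have [U [e /universal_int eP]] := H (Y, A).
  by exists U, (runit Y ∘ e).
case=> Y V; have [U [e eP]] := (has_right_adjointP _).1 (H V) Y.
(* [runit_inv Y] gives [e] the codomain [Y ⊗ I] required of a map into [(Y, V)]. *)
exists U, (runit_inv Y ∘ e); apply/universal_int.
by rewrite compK_l // runit_invK.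
Qed.
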